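(* GCAI for $f^{\mathrm{CSR}}$ is polynomial-time solvable when restricted to instances whose profile $\varphi$ is QC.
   Context: A profile over a finite set $N$ of individuals is a map $\varphi:N\times N\to\{0,1\}$; $\varphi(a,a')=1$ means $a$ qualifies $a'$. A profile is QC (qualifying consecutive) if there is a linear order $(a_1,\dots,a_n)$ of $N$ such that for every $a\in N$ all 1s in $(\varphi(a,a_1),\dots,\varphi(a,a_n))$ are consecutive. Consensus-start-respecting rule: for $T\subseteq N$, let $K_0(\varphi,T)=\{a\in T:\varphi(a',a)=1\text{ for all }a'\in T\}$ and for $\ell\ge1$, $K_\ell(\varphi,T)=K_{\ell-1}(\varphi,T)\cup\{a\in T:\exists a'\in K_{\ell-1}(\varphi,T),\ \varphi(a',a)=1\}$; $f^{\mathrm{CSR}}(\varphi,T)$ is the limit of this sequence. GCAI for a rule $f$: Input: $(N,\varphi,S,T,k)$ with nonempty $S\subseteq T\subseteq N$ and an integer $k$. Question: is there $U\subseteq N\setminus T$ with $|U|\le k$ and $S\subseteq f(\varphi,T\cup U)$? *)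

(* Defs.v *)
From mathcomp Require Import all_boot all_order all_algebra all_fingroup.
Set Implicit Arguments. Unset Strict Implicit. Unset Printing Implicit Defensive.

(* The finite set of individuals N is represented by 'I_n.            *)

Definition profile (n : nat) := 'I_n -> 'I_n -> bool.

(* QC: there is a linear order (a_1,...,a_n) of N, given as a bijection
   sigma : 'I_n -> 'I_n (position -> individual), such that for every a
   the 1s of (phi a (sigma 0), ..., phi a (sigma (n-1))) are consecutive. *)
Definition QC (n : nat) (phi : profile n) : Prop :=
  exists sigma : {perm 'I_n},
    forall (a : 'I_n) (i j l : 'I_n),
      (i <= j)%N -> (j <= l)%N ->
      phi a (sigma i) -> phi a (sigma l) -> phi a (sigma j).

Fixpoint csrK (n : nat) (phi : profile n) (T : {set 'I_n}) (l : nat)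
  : {set 'I_n} :=
  match l with
  | 0 => [set a in T | [forall a' in T, phi a' a]]
  | l'.+1 => csrK phi T l' :|:
             [set a in T | [exists a' in csrK phi T l', phi a' a]]
  end.

Definition in_fCSR (n : nat) (phi : profile n) (T : {set 'I_n}) (a : 'I_n)
  : Prop := exists l, a \in csrK phi T l.

Definition GCAI_CSR (n : nat) (phi : profile n) (S T : {set 'I_n}) (k : int)
  : Prop :=
  exists U : {set 'I_n},
    [/\ U \subset ~: T, (Posz #|U| <= k)%R &
        forall a, a \in S -> in_fCSR phi (T :|: U) a].

(* Model of computation: unit-cost RAM with addition and (truncated)  *)
(* subtraction, direct registers and an indirectly addressed memory.  *)

Inductive instr : Type :=
| IConst of nat & nat
| IAdd   of nat & nat & nat
| ISub   of nat & nat & nat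
| ILoad  of nat & nat
| IStore of nat & nat
| IJz    of nat & nat
| IHalt.

Record config := Config { pc : nat; reg : nat -> nat; mem : nat -> nat }.

Definition upd (f : nat -> nat) (x v : nat) : nat -> nat :=
  fun y => if y == x then v else f y.

Definition fetch (P : seq instr) (c : config) : instr := nth IHalt P (pc c).

Definition halted (P : seq instr) (c : config) : bool :=
  if fetch P c is IHalt then true else false.

Definition step (P : seq instr) (c : config) : config :=
  let: Config p R M := c in
  match fetch P c with
  | IConst r v => Config p.+1 (upd R r v) M
  | IAdd d a b => Config p.+1 (upd R d (R a + R b)) M
  | ISub d a b => Config p.+1 (upd R d (R a - R b)) M
  | ILoad d a => Config p.+1 (upd R d (M (R a))) M
  | IStore a s => Config p.+1 R (upd M (R a) (R s))
  | IJz r t => Config (if R r == 0 then t else p.+1) R M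
  | IHalt => c
  end.

Fixpoint run (P : seq instr) (t : nat) (c : config) : option nat :=
  if halted P c then Some (reg c 0)
  else match t with
       | 0 => None
       | t'.+1 => run P t' (step P c)
       end.

Definition init_config (w : seq nat) : config :=
  Config 0 (upd (fun _ => 0) 0 (size w)) (fun i => nth 0 w i).

Definition encode_instance (n : nat) (phi : profile n) (S T : {set 'I_n})
  (k : int) : seq nat :=
  [:: n; nat_of_bool (k < 0)%R; `|k|%N] ++
  [seq nat_of_bool (phi a b) | a <- enum 'I_n, b <- enum 'I_n] ++
  [seq nat_of_bool (a \in S) | a <- enum 'I_n] ++
  [seq nat_of_bool (a \in T) | a <- enum 'I_n].

(* Main.v *)
Require Import Defs.
From mathcomp Require Import all_boot all_order all_algebra all_fingroup.
From mathcomp Require Import zify.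

(** Let T' be T together with the added individuals and c a consensus start of
    T'. Everybody in T' qualifies c, and f^CSR(T') is the set of individuals
    reachable from c inside T'. Under a QC order every row restricted to T' is
    an interval containing c, so that, as soon as some s in T' is reached,
    everyone of T' located between s and c is reached as well: all of S is
    reached if and only if the two extreme members of S are. Adding as few
    individuals as possible is thus a directed Steiner problem with one root
    and only two terminals s1, s2, and an optimal solution consists of a path
    from c to a branching vertex v and two paths from v to s1 and to s2.

    The order itself is never computed: quantifying over all pairs s1, s2 of S
    includes the extreme pair, and a solution for S solves every pair. The
    individual costs of the three paths are read off a boolean table indexed
    by (c, b, x, y), telling whether x reaches y at cost at most b through
    individuals qualifying c; n rounds of in-place relaxation fill it.

    The algorithm is written in a small language of loops "for i < n", whose
    running time is bounded by a polynomial in n read off the syntax, and which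
    is compiled to the RAM. *)

(** * A loop language and its compilation to the RAM *)

Inductive expr : Type :=
| Var of nat
| Cst of nat
| Dim
| Plus of expr & expr
| Minus of expr & expr
| Get of expr
| Sum of nat & expr.

Inductive cmd : Type :=
| Put of expr & expr
| For of nat & cmd.

Section Semantics.
Variable N : nat.

Fixpoint eval (M V : nat -> nat) (e : expr) : nat :=
  match e with
  | Var v => V v
  | Cst k => k
  | Dim => N
  | Plus a b => eval M V a + eval M V b
  | Minus a b => eval M V a - eval M V b
  | Get a => M (eval M V a)
  | Sum i a => \sum_(j < N) eval M (upd V i j) a
  end.

Fixpoint exec (V : nat -> nat) (c : cmd) (M : nat -> nat) : nat -> nat :=
  match c with
  | Put a e => upd M (eval M V a) (eval M V e)
  | For i b => iteri N (fun j => exec (upd V i j) b) M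
  end.

(** Bounds the RAM steps of the compiled code. A loop pays 9 once (six instructions of preparation,
    the last test, a move of two) and 5 per round: the test, two counter updates and a jump back
    that takes two instructions. *)
Fixpoint ecost (e : expr) : nat :=
  match e with
  | Var _ | Cst _ | Dim => 2
  | Plus a b | Minus a b => ecost a + ecost b + 1
  | Get a => ecost a + 1
  | Sum _ a => 1 + (9 + N * (ecost a + 1 + 5))
  end.

Fixpoint ccost (c : cmd) : nat :=
  match c with
  | Put a e => ecost a + ecost e + 1
  | For _ b => 9 + N * (ccost b + 5)
  end.
End Semantics.

(* Program variables live in even registers and temporaries in odd ones;
   [tmp 0] permanently holds the loop bound n. *)
Definition tmp (p : nat) : nat := p.*2.+1.
Definition var (v : nat) : nat := v.*2.

Definition move (d s : nat) : seq instr := [:: IConst d 0; IAdd d d s].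

(* The counter register of variable [i] is saved first and restored at the end,
   so that nested loops may reuse a variable, as in [eval] and [exec]. *)
Definition loop (p o i : nat) (body : seq instr) : seq instr :=
  move (tmp p) (var i) ++ move (tmp p.+1) (tmp 0) ++
  [:: IConst (tmp p.+2) 1; IConst (var i) 0;
      IJz (tmp p.+1) (o + 11 + size body)] ++
  body ++
  [:: IAdd (var i) (var i) (tmp p.+2); ISub (tmp p.+1) (tmp p.+1) (tmp p.+2);
      IConst (tmp p.+3) 0; IJz (tmp p.+3) (o + 6)] ++
  move (var i) (tmp p).

(** The value ends up in [tmp p] and the temporaries below [p] are left alone, so the temporaries
    act as a stack. Jump targets are absolute, hence the address [o]. In [Sum] the loop occupies
    [tmp p.+1] to [tmp p.+4], so the summand is compiled at level [p.+4.+1]. *)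
Fixpoint cexpr (p o : nat) (e : expr) : seq instr :=
  match e with
  | Var v => move (tmp p) (var v)
  | Cst k => [:: IConst (tmp p) k]
  | Dim => move (tmp p) (tmp 0)
  | Plus a b =>
      let ca := cexpr p o a in
      ca ++ cexpr p.+1 (o + size ca) b ++ [:: IAdd (tmp p) (tmp p) (tmp p.+1)]
  | Minus a b =>
      let ca := cexpr p o a in
      ca ++ cexpr p.+1 (o + size ca) b ++ [:: ISub (tmp p) (tmp p) (tmp p.+1)]
  | Get a => cexpr p o a ++ [:: ILoad (tmp p) (tmp p)]
  | Sum i a =>
      IConst (tmp p) 0 ::
      loop p.+1 o.+1 i
        (cexpr p.+4.+1 (o + 8) a ++ [:: IAdd (tmp p) (tmp p) (tmp p.+4.+1)])
  end.

Fixpoint ccmd (p o : nat) (c : cmd) : seq instr :=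
  match c with
  | Put a e =>
      let ca := cexpr p o a in
      ca ++ cexpr p.+1 (o + size ca) e ++ [:: IStore (tmp p) (tmp p.+1)]
  | For i b => loop p o i (ccmd p.+4 (o + 7) b)
  end.

(** * Correctness and running time of the compiled code *)

Section Machine.
Variable P : seq instr.

Definition sits (o : nat) (code : seq instr) : Prop :=
  forall k, k < size code -> nth IHalt P (o + k) = nth IHalt code k.

Lemma sits_cons o i code :
  sits o (i :: code) -> nth IHalt P o = i /\ sits o.+1 code.
Proof.
move=> h; split; first by rewrite -[o]addn0 (h 0).
by move=> k lk; rewrite addSnnS (h k.+1).
Qed.

Lemma sits_cat o c1 c2 :
  sits o (c1 ++ c2) -> sits o c1 /\ sits (o + size c1) c2.
Proof.
move=> h; split=> k lk.
  by rewrite h ?nth_cat ?lk // size_cat ltn_addr.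
by rewrite -addnA h ?size_cat ?ltn_add2l // nth_cat ltnNge leq_addr addKn.
Qed.

Definition reach (T : nat) (c c' : config) : Prop :=
  exists2 s, s <= T & iter s (step P) c = c'.

Lemma reach_refl c : reach 0 c c.
Proof. by exists 0. Qed.

Lemma reach_at o o' R M : o = o' -> reach 0 (Config o R M) (Config o' R M).
Proof. by move=> ->; apply: reach_refl. Qed.

Lemma reach_trans T1 T2 c1 c2 c3 :
  reach T1 c1 c2 -> reach T2 c2 c3 -> reach (T1 + T2) c1 c3.
Proof.
move=> [s1 l1 e1] [s2 l2 e2]; exists (s2 + s1); first by rewrite addnC leq_add.
by rewrite iterD e1.
Qed.

Lemma reach_step T c c' : reach T (step P c) c' -> reach T.+1 c c'.
Proof. by move=> [s ls e]; exists s.+1 => //; rewrite iterSr. Qed.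

Lemma reach_leq T T' c c' : T <= T' -> reach T c c' -> reach T' c c'.
Proof. by move=> lT [s ls e]; exists s => //; apply: leq_trans lT. Qed.

(** Halted configurations are fixed points of [step], so a run that stops early agrees with the
    iteration carried on to [c']. *)
Lemma reach_run T c c' :
  reach T c c' -> halted P c' -> run P T c = Some (reg c' 0).
Proof.
move=> [s ls e] hc'; elim: T s c ls e => [|T IH] s c.
  by rewrite leqn0 => /eqP-> /= ->; rewrite hc'.
case: s => [|s] ls; first by move=> /= ->; rewrite hc'.
rewrite iterSr /=; case: ifP => hc; last exact: IH.
have -> : step P c = c.
  by move: hc; rewrite /halted; case: c => pc R M /=; case: fetch.
have fix_c : iter s (step P) c = c.
  elim: s {ls} => //= s ->.
  by move: hc; rewrite /halted; case: c => pc R M /=; case: fetch.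
by rewrite fix_c => ->.
Qed.

Lemma step_at o i R M : nth IHalt P o = i ->
  step P (Config o R M) =
  match i with
  | IConst r v => Config o.+1 (upd R r v) M
  | IAdd d a b => Config o.+1 (upd R d (R a + R b)) M
  | ISub d a b => Config o.+1 (upd R d (R a - R b)) M
  | ILoad d a => Config o.+1 (upd R d (M (R a))) M
  | IStore a s => Config o.+1 R (upd M (R a) (R s))
  | IJz r t => Config (if R r == 0 then t else o.+1) R M
  | IHalt => Config o R M
  end.
Proof. by move=> h; rewrite /step /fetch /= h. Qed.

Lemma reach_move o d s R M : sits o (move d s) -> d <> s ->
  exists R', [/\ reach 2 (Config o R M) (Config o.+2 R' M), R' d = R s &
                 forall r, r <> d -> R' r = R r].
Proof.
move=> /sits_cons[h1 /sits_cons[h2 _]] ds.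
exists (upd (upd R d 0) d (R s)); split.
- apply: reach_step; rewrite (step_at _ _ _ _ h1).
  apply: reach_step; rewrite (step_at _ _ _ _ h2) /upd eqxx.
  by move/nesym/eqP/negbTE: ds => ->; apply: reach_refl.
- by rewrite /upd eqxx.
- by move=> r /eqP/negbTE rd; rewrite /upd rd.
Qed.

(** The registers that code compiled at level [p] must preserve: all variables and the temporaries
    below [p]. *)
Definition low (p r : nat) : Prop := forall q, p <= q -> r <> tmp q.

Lemma low_var p v : low p (var v).
Proof. by move=> q _; rewrite /var /tmp; lia. Qed.

Lemma low_tmp p q : q < p -> low p (tmp q).
Proof. by move=> qp r; rewrite /tmp; lia. Qed.

Lemma low_leq p q r : p <= q -> low p r -> low q r.
Proof. by move=> pq h s qs; apply: h; apply: leq_trans qs. Qed.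

Lemma var_inj v w : var v = var w -> v = w.
Proof. by rewrite /var; lia. Qed.

Variable N : nat.

(** Hoare rule for [loop]. Among the registers, the invariant [I] may depend only on those that the
    loop leaves alone. The body must preserve the counter and the three temporaries from [tmp p] on,
    which hold the saved counter, the number of rounds left and the constant 1. *)
Lemma reach_loop p o i body T (I : nat -> (nat -> nat) -> (nat -> nat) -> Prop)
    R M :
  sits o (loop p o i body) -> 0 < p -> R (tmp 0) = N ->
  (forall j R1 R2 M1, (forall r, low p r -> r <> var i -> R1 r = R2 r) ->
     I j R1 M1 -> I j R2 M1) ->
  (forall j R1 M1, j < N -> I j R1 M1 -> R1 (var i) = j ->
     exists R2 M2,
       [/\ reach T (Config (o + 7) R1 M1) (Config (o + 7 + size body) R2 M2),
           I j.+1 R2 M2, R2 (var i) = j &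
           forall q, q < 3 -> R2 (tmp (p + q)) = R1 (tmp (p + q))]) ->
  I 0 R M ->
  exists R' M',
    [/\ reach (9 + N * (T + 5)) (Config o R M)
          (Config (o + size (loop p o i body)) R' M'),
        I N R' M' & R' (var i) = R (var i)].
Proof.
move=> + p0 RN ext step_body I0.
rewrite {1}/loop.
move=> /sits_cat[s1] /sits_cat[s2] /sits_cons[s3] /sits_cons[s4] /sits_cons[s5].
move=> /sits_cat[_] /sits_cons[s6] /sits_cons[s7] /sits_cons[s8] /sits_cons[s9].
move=> s10; rewrite /= in s2 s3 s4 s5 s6 s7 s8 s9 s10.
have [|R1 [r1 R1p R1o]] := reach_move _ _ _ R M s1.
  by rewrite /tmp /var; lia.
have [|R2 [r2 R2p R2o]] := reach_move _ _ _ R1 M s2.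
  by rewrite /tmp; lia.
have e6 : (o + 2 + 2).+2 = o + 6 by lia.
rewrite e6 in s5.
set R3 := upd (upd R2 (tmp p.+2) 1) (var i) 0.
have R3u r : R3 r = if r == var i then 0 else if r == tmp p.+2 then 1 else R2 r.
  by [].
(* Induction on the number [d] of rounds left, starting from the loop test at address [o + 6], with
   [j] rounds done. *)
have main : forall d j R4 M4, j + d = N -> I j R4 M4 -> R4 (var i) = j ->
    R4 (tmp p) = R (var i) -> R4 (tmp p.+1) = d -> R4 (tmp p.+2) = 1 ->
  exists R' M', [/\ reach (d * (T + 5) + 3) (Config (o + 6) R4 M4)
          (Config (o + 13 + size body) R' M'),
        I N R' M' & R' (var i) = R (var i)].
  elim=> [|d IH] j R4 M4 jd Ij R4i R4p R4p1 R4p2.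
    have [|R5 [r5 R5i R5o]] := reach_move _ _ _ R4 M4 s10.
      by rewrite /tmp /var; lia.
    exists R5, M4; split; last by rewrite R5i.
      rewrite mul0n add0n; apply: reach_step; rewrite (step_at _ _ _ _ s5).
      rewrite R4p1 eqxx; move: r5.
      congr (reach _ (Config _ _ _) (Config _ _ _)); lia.
    rewrite addn0 in jd; rewrite -jd; apply: ext Ij => r lr ri.
    by rewrite R5o.
  have [|R5 [M5 [r5 I5 R5i R5o]]] := step_body j R4 M4 _ Ij R4i; first by lia.
  have := R5o 0 isT; rewrite addn0 R4p => R5p.
  have := R5o 1 isT; rewrite addn1 R4p1 => R5p1.
  have := R5o 2 isT; rewrite addn2 R4p2 => R5p2.
  set Ra := upd R5 (var i) (R5 (var i) + R5 (tmp p.+2)).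
  set Rb := upd Ra (tmp p.+1) (Ra (tmp p.+1) - Ra (tmp p.+2)).
  set R6 := upd Rb (tmp p.+3) 0.
  have Ra_tmp q : Ra (tmp q) = R5 (tmp q).
    by rewrite /Ra /upd /var /tmp; case: eqP => // ?; lia.
  have R6o r : r <> var i -> r <> tmp p.+1 -> r <> tmp p.+3 -> R6 r = R5 r.
    move=> /eqP/negbTE a /eqP/negbTE b /eqP/negbTE c.
    by rewrite /R6 /Rb /Ra /upd a b c.
  have R6p1 : R6 (tmp p.+1) = d.
    rewrite /R6 {1}/upd /tmp; case: eqP => [|_]; first by lia.
    by rewrite /Rb /upd eqxx !Ra_tmp R5p1 R5p2; lia.
  have R6i : R6 (var i) = j.+1.
    rewrite /R6 /Rb /Ra /upd R5i R5p2 eqxx /var /tmp.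
    by do 2![case: eqP => [|_]; first by lia]; lia.
  have [||||||R' [M' [r' I' R'i]]] := IH j.+1 R6 M5; rewrite ?R6i ?R6p1 //.
  - by lia.
  - apply: ext I5 => r lr ri; rewrite R6o //; apply: lr; lia.
  - by rewrite R6o // /var /tmp; lia.
  - by rewrite R6o // /var /tmp; lia.
  exists R', M'; split=> //.
  have -> : d.+1 * (T + 5) + 3 = (T + (4 + (d * (T + 5) + 3))).+1 by lia.
  apply: reach_step; rewrite (step_at _ _ _ _ s5).
  rewrite R4p1 /=.
  have -> : (o + 6).+1 = o + 7 by lia.
  apply: reach_trans r5 _.
  have e1 : o + 2 + 2 + 3 + size body = o + 7 + size body by lia.
  have e2 : (o + 2 + 2).+3 + size body = o + 7 + size body by lia.
  rewrite ?e1 ?e2 in s6 s7 s8 s9.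
  apply: reach_step; rewrite (step_at _ _ _ _ s6).
  apply: reach_step; rewrite (step_at _ _ _ _ s7).
  apply: reach_step; rewrite (step_at _ _ _ _ s8).
  apply: reach_step; rewrite (step_at _ _ _ _ s9).
  by rewrite {1}/upd eqxx.
have [||||||R' [M' [r' I' R'i]]] := main N 0 R3 M.
- by [].
- apply: ext I0 => r lr ri; rewrite R3u.
  case: eqP => // _; case: eqP => [re|_]; first by case: (lr p.+2) => //; lia.
  by rewrite R2o ?R1o //; apply: lr; lia.
- by rewrite R3u eqxx.
- rewrite R3u /tmp /var; do 2![case: eqP => [|_]; first by lia].
  by rewrite R2o // /tmp; lia.
- rewrite R3u /tmp /var; do 2![case: eqP => [|_]; first by lia].
  by rewrite R2p R1o // /tmp; lia.
- by rewrite R3u eqxx /tmp /var; case: eqP => // ?; lia.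
exists R', M'; split=> //.
have -> : 9 + N * (T + 5) = 2 + (2 + (2 + (N * (T + 5) + 3))) by lia.
apply: reach_trans r1 _.
have e0 : o.+2 = o + 2 by lia.
rewrite e0; apply: reach_trans r2 _.
have e1 : (o + 2).+2 = o + 2 + 2 by lia.
rewrite e1.
apply: reach_step; rewrite (step_at _ _ _ _ s3).
apply: reach_step; rewrite (step_at _ _ _ _ s4).
move: r'; congr (reach _ (Config _ _ _) (Config _ _ _)); first by lia.
by rewrite /loop !size_cat /=; lia.
Qed.

Lemma reach_cexpr e p o V R M :
  sits o (cexpr p o e) -> 0 < p -> R (tmp 0) = N ->
  (forall v, R (var v) = V v) ->
  exists R',
    [/\ reach (ecost N e) (Config o R M) (Config (o + size (cexpr p o e)) R' M),
        R' (tmp p) = eval N M V e & forall r, low p r -> R' r = R r].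
Proof.
elim: e p o V R => [v|k||a IHa b IHb|a IHa b IHb|a IHa|i a IHa] p o V R st p0 RN RV.
- rewrite /= in st *; have [|R' [r' R'p R'o]] := reach_move _ _ _ R M st.
    by rewrite /tmp /var; lia.
  exists R'; split; rewrite ?addn2 ?R'p //.
  by move=> r lr; apply: R'o; apply: lr.
- rewrite /= in st *; have [s1 _] := sits_cons _ _ _ st.
  exists (upd R (tmp p) k); split.
  + by apply: reach_step; rewrite (step_at _ _ _ _ s1) addn1; apply: reach_leq (reach_refl _).
  + by rewrite /upd eqxx.
  + by move=> r lr; rewrite /upd; case: eqP => // re; case: (lr p).
- rewrite /= in st *; have [|R' [r' R'p R'o]] := reach_move _ _ _ R M st.
    by rewrite /tmp; lia.
  exists R'; split; rewrite ?addn2 ?R'p //.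
  by move=> r lr; apply: R'o; apply: lr.
- move: st => /= /sits_cat[sa] /sits_cat[sb] /sits_cons[s1 _].
  have [Ra [ra Rap Rao]] := IHa _ _ _ _ sa p0 RN RV.
  have [||Rb [rb Rbp Rbo]] := IHb p.+1 _ V Ra sb isT.
  + by rewrite Rao //; apply: low_tmp.
  + by move=> v; rewrite Rao //; apply: low_var.
  exists (upd Rb (tmp p) (Rb (tmp p) + Rb (tmp p.+1))); split.
  + apply: reach_trans (reach_trans _ _ _ _ _ ra rb) _.
    apply: reach_step; rewrite (step_at _ _ _ _ s1).
    by apply: reach_at; rewrite !size_cat /=; lia.
  + rewrite /upd eqxx Rbp Rbo ?Rap //; exact: low_tmp.
  + move=> r lr; rewrite /upd; case: eqP => [re|_]; first by case: (lr p).
    by rewrite Rbo ?Rao //; apply: low_leq lr.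
- move: st => /= /sits_cat[sa] /sits_cat[sb] /sits_cons[s1 _].
  have [Ra [ra Rap Rao]] := IHa _ _ _ _ sa p0 RN RV.
  have [||Rb [rb Rbp Rbo]] := IHb p.+1 _ V Ra sb isT.
  + by rewrite Rao //; apply: low_tmp.
  + by move=> v; rewrite Rao //; apply: low_var.
  exists (upd Rb (tmp p) (Rb (tmp p) - Rb (tmp p.+1))); split.
  + apply: reach_trans (reach_trans _ _ _ _ _ ra rb) _.
    apply: reach_step; rewrite (step_at _ _ _ _ s1).
    by apply: reach_at; rewrite !size_cat /=; lia.
  + rewrite /upd eqxx Rbp Rbo ?Rap //; exact: low_tmp.
  + move=> r lr; rewrite /upd; case: eqP => [re|_]; first by case: (lr p).
    by rewrite Rbo ?Rao //; apply: low_leq lr.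
- move: st => /= /sits_cat[sa] /sits_cons[s1 _].
  have [Ra [ra Rap Rao]] := IHa _ _ _ _ sa p0 RN RV.
  exists (upd Ra (tmp p) (M (Ra (tmp p)))); split.
  + apply: reach_trans ra _.
    apply: reach_step; rewrite (step_at _ _ _ _ s1).
    by apply: reach_at; rewrite !size_cat /=; lia.
  + by rewrite /upd eqxx Rap.
  + move=> r lr; rewrite /upd; case: eqP => [re|_]; first by case: (lr p).
    by rewrite Rao.
- pose body := cexpr p.+4.+1 (o + 8) a ++ [:: IAdd (tmp p) (tmp p) (tmp p.+4.+1)].
  have [s0 sl] : nth IHalt P o = IConst (tmp p) 0 /\
                 sits o.+1 (loop p.+1 o.+1 i body) by apply: sits_cons st.
  (* The accumulator [tmp p] lies below the registers of the loop, which start at [tmp p.+1], so the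
     invariant may mention it. *)
  pose I j R1 M1 := [/\ M1 = M, R1 (tmp p) = \sum_(k < j) eval N M (upd V i k) a &
                     forall r, low p r -> r <> var i -> R1 r = R r].
  have [sb] : sits (o + 8) (cexpr p.+4.+1 (o + 8) a) /\
              sits (o + 8 + size (cexpr p.+4.+1 (o + 8) a))
                   [:: IAdd (tmp p) (tmp p) (tmp p.+4.+1)].
    apply: sits_cat; have := sl; rewrite /loop.
    move=> /sits_cat[_] /sits_cat[_] /sits_cat[_] /sits_cat[sb _].
    by move: sb; congr sits; rewrite /=; lia.
  move=> /sits_cons[s1 _].
  have [||||R' [M' [r' [eM R'p R'o] R'i]]] := reach_loop p.+1 o.+1 i body
    (ecost N a + 1) I (upd R (tmp p) 0) M sl isT.
  + by rewrite /upd /tmp; case: eqP => // ?; lia.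
  + move=> j R1 R2 M1 e12 [-> R1p R1o]; split=> //.
      by rewrite -e12 //; [apply: low_tmp | rewrite /tmp /var; lia].
    move=> r lr ri; rewrite -e12 ?R1o //; exact: low_leq lr.
  + move=> j R1 M1 jN [-> R1p R1o] R1i.
    have [||R2 [r2 R2p R2o]] := IHa p.+4.+1 (o + 8) (upd V i j) R1 sb isT.
    * by rewrite R1o //; [apply: low_tmp | rewrite /tmp /var; lia].
    * move=> v; rewrite /upd; case: eqP => [->//|vi].
      by rewrite R1o ?RV //; [apply: low_var | move=> /var_inj].
    exists (upd R2 (tmp p) (R2 (tmp p) + R2 (tmp p.+4.+1))), M; split.
    * have -> : o.+1 + 7 = o + 8 by lia.
      apply: reach_trans r2 _; apply: reach_step; rewrite (step_at _ _ _ _ s1).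
      by apply: reach_at; rewrite /body !size_cat /=; lia.
    * split=> //.
        rewrite /upd eqxx R2p big_ord_recr /= R2o ?R1p //.
        apply: low_tmp; lia.
      move=> r lr ri; rewrite /upd; case: eqP => [re|_]; first by case: (lr p).
      by rewrite R2o ?R1o //; apply: low_leq lr; lia.
    * rewrite /upd; case: eqP => [|_]; first by rewrite /var /tmp; lia.
      by rewrite R2o //; apply: low_var.
    * move=> q q3; rewrite /upd; case: eqP => [|_]; first by rewrite /tmp; lia.
      by rewrite R2o //; apply: low_tmp; lia.
  + split=> //; first by rewrite /upd eqxx big_ord0.
    by move=> r lr _; rewrite /upd; case: eqP => // re; case: (lr p).
  rewrite {}eM in r'; exists R'; split; last first.
  + move=> r lr; have [->|/eqP ri] := eqVneq r (var i); last exact: R'o.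
    rewrite R'i /upd; case: eqP => //; rewrite /var /tmp; lia.
  + exact: R'p.
  + apply: reach_step; rewrite (step_at _ _ _ _ s0).
    by move: r'; rewrite [o.+1 + _]addSnnS.
Qed.

Lemma reach_ccmd c p o V R M :
  sits o (ccmd p o c) -> 0 < p -> R (tmp 0) = N ->
  (forall v, R (var v) = V v) ->
  exists R',
    [/\ reach (ccost N c) (Config o R M)
          (Config (o + size (ccmd p o c)) R' (exec N V c M)) &
        forall r, low p r -> R' r = R r].
Proof.
elim: c p o V R M => [a e|i b IHb] p o V R M st p0 RN RV.
- move: st => /= /sits_cat[sa] /sits_cat[sb] /sits_cons[s1 _].
  have [Ra [ra Rap Rao]] := reach_cexpr _ _ _ _ _ M sa p0 RN RV.
  have [||Rb [rb Rbp Rbo]] := reach_cexpr e p.+1 _ V Ra M sb isT.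
  + by rewrite Rao //; apply: low_tmp.
  + by move=> v; rewrite Rao //; apply: low_var.
  exists Rb; split.
  + apply: reach_trans (reach_trans _ _ _ _ _ ra rb) _.
    apply: reach_step; rewrite (step_at _ _ _ _ s1) Rbp Rbo ?Rap; last exact: low_tmp.
    by apply: reach_at; rewrite !size_cat /=; lia.
  + by move=> r lr; rewrite Rbo ?Rao //; apply: low_leq lr.
- pose body := ccmd p.+4 (o + 7) b.
  have {}st : sits o (loop p o i body) by [].
  pose I j R1 M1 := M1 = iteri j (fun k => exec N (upd V i k) b) M /\
                    forall r, low p r -> r <> var i -> R1 r = R r.
  have sb : sits (o + 7) body.
    have := st; rewrite /loop.
    move=> /sits_cat[_] /sits_cat[_] /sits_cat[_] /sits_cat[sb _].
    by move: sb; congr sits; rewrite /=; lia.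
  have [|||R' [M' [r' [eM R'o] R'i]]] := reach_loop p o i body
    (ccost N b) I R M st p0 RN.
  + move=> j R1 R2 M1 e12 [-> R1o]; split=> // r lr ri.
    by rewrite -e12 ?R1o.
  + move=> j R1 M1 jN [-> R1o] R1i.
    have [||R2 [r2 R2o]] := IHb p.+4 (o + 7) (upd V i j) R1
      (iteri j (fun k => exec N (upd V i k) b) M) sb isT.
    * by rewrite R1o //; [apply: low_tmp | rewrite /tmp /var; lia].
    * move=> v; rewrite /upd; case: eqP => [->//|vi].
      by rewrite R1o ?RV //; [apply: low_var | move=> /var_inj].
    exists R2, (iteri j.+1 (fun k => exec N (upd V i k) b) M); split=> //.
    * split=> // r lr ri; rewrite R2o ?R1o //; apply: low_leq lr; lia.
    * by rewrite R2o //; apply: low_var.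
    * by move=> q q3; rewrite R2o //; apply: low_tmp; lia.
  + by [].
  rewrite {}eM in r'; exists R'; split; first exact: r'.
  move=> r lr.
  by have [->|/eqP ri] := eqVneq r (var i); last exact: R'o.
Qed.
End Machine.

(** * Polynomial time bounds and complete programs *)

Definition poly_bounded (f : nat -> nat) : Prop :=
  exists A d, forall N, f N <= A * N.+1 ^ d.

Lemma poly_bounded_cst k : poly_bounded (fun _ => k).
Proof. by exists k, 0 => N; rewrite expn0 muln1. Qed.

Lemma poly_boundedD f g :
  poly_bounded f -> poly_bounded g -> poly_bounded (fun N => f N + g N).
Proof.
move=> [A [d hA]] [B [e hB]]; exists (A + B), (d + e) => N.
rewrite mulnDl leq_add // (leq_trans (hA N), leq_trans (hB N)) // leq_mul2l;
  by rewrite leq_pexp2l ?leq_addr ?leq_addl ?orbT.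
Qed.

Lemma poly_boundedMN f : poly_bounded f -> poly_bounded (fun N => N * f N).
Proof.
move=> [A [d hA]]; exists A, d.+1 => N.
by rewrite expnS mulnCA leq_mul.
Qed.

Lemma ecost_poly e : poly_bounded (ecost^~ e).
Proof.
elim: e => [v|k||a IHa b IHb|a IHa b IHb|a IHa|i a IHa] /=;
  by do ?[apply: poly_boundedD | apply: poly_boundedMN];
     rewrite //; apply: poly_bounded_cst.
Qed.

Lemma ccost_poly c : poly_bounded (ccost^~ c).
Proof.
elim: c => [a e|i b IHb] /=;
  by do ?[apply: poly_boundedD | apply: poly_boundedMN];
     rewrite //; try apply: ecost_poly; apply: poly_bounded_cst.
Qed.

(** Memory cell 0 holds n; the first two instructions bring it into [tmp 0], hence level 1 and
    address 2 for the rest. The result is moved to [var 0], the register read by [run]. *)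
Definition compile (c : cmd) (e : expr) : seq instr :=
  let code := ccmd 1 2 c in
  [:: IConst (tmp 0) 0; ILoad (tmp 0) (tmp 0)] ++ code ++
  cexpr 1 (2 + size code) e ++ move (var 0) (tmp 1) ++ [:: IHalt].

(** Register 0, which is [var 0], initially contains the input length; this explains [V]. Since
    [N <= size w], a time bound polynomial in [N] is polynomial in the input length. *)
Lemma run_compile c e : exists A d, forall w : seq nat,
  let N := nth 0 w 0 in let V := fun v => if v is 0 then size w else 0 in
  N <= size w ->
  run (compile c e) (A * (size w).+1 ^ d) (init_config w) =
    Some (eval N (exec N V c (nth 0 w)) V e).
Proof.
have [A [d hA]] : poly_bounded (fun N => 2 + (ccost N c + (ecost N e + 2))).
  apply: poly_boundedD (poly_bounded_cst 2) _.
  apply: poly_boundedD (ccost_poly c) _.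
  exact: poly_boundedD (ecost_poly e) (poly_bounded_cst 2).
exists A, d => w N V Nw; set P := compile c e.
have : sits P 0 P by [].
rewrite {2}/P /compile => /sits_cons[s1 /sits_cons[s2]] /sits_cat[s3] /sits_cat[s4].
move=> /sits_cat[s5] /sits_cons[s6 _].
set R0 := upd (fun _ => 0) 0 (size w).
set R1 := upd (upd R0 (tmp 0) 0) (tmp 0) N.
have R1N : R1 (tmp 0) = N by [].
have R1V v : R1 (var v) = V v by case: v.
have [R2 [r2 R2o]] := reach_ccmd _ _ _ _ _ _ _ (nth 0 w) s3 isT R1N R1V.
set M2 := exec N V c (nth 0 w) in r2 *.
have [||R3 [r3 R3p _]] := reach_cexpr P N e 1 (2 + size (ccmd 1 2 c)) V R2 M2 s4 isT.
- by rewrite R2o //; apply: low_tmp.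
- by move=> v; rewrite R2o //; apply: low_var.
have [|R4 [r4 R4p _]] := reach_move _ _ _ _ R3 M2 s5; first by [].
rewrite -R3p -R4p -[R4 _]/(reg (Config (2 + size (ccmd 1 2 c) +
  size (cexpr 1 (2 + size (ccmd 1 2 c)) e) + 2) R4 M2) 0).
apply: reach_run; last by rewrite /halted /fetch [nth _ _ _]s6.
apply: reach_leq (_ : 2 + (ccost N c + (ecost N e + 2)) <= _) _.
  apply: leq_trans (hA N) _; rewrite leq_mul2l; apply/orP; right.
  by case: (posnP d) => [->//|d0]; rewrite leq_exp2r.
apply: reach_step; rewrite (step_at _ _ _ _ _ s1).
apply: reach_step; rewrite (step_at _ _ _ _ _ s2).
apply: reach_trans r2 _; apply: reach_trans r3 _.
by rewrite addn2.
Qed.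

(** * The algorithm *)

(* A boolean is encoded by any number, 0 meaning false: disjunction is [Plus]
   and existential quantification is [Sum]. *)
Definition Not e := Minus (Cst 1) e.
Definition And a b := Not (Plus (Not a) (Not b)).
Definition Leq a b := Not (Minus a b).
Definition All i e := Not (Sum i (Not e)).
(* Variable 0 serves as the dummy index, hence the successors further down. *)
Definition Mul e := Sum 0 e.

(** * Truth values of formulas *)

Section Formulas.
Variables (N : nat) (M V : nat -> nat).

Definition holds e := eval N M V e != 0.

Lemma holds_not e : holds (Not e) = ~~ holds e.
Proof. by rewrite /holds /=; case: (eval N M V e). Qed.

Lemma holds_and a b : holds (And a b) = holds a && holds b.
Proof. by rewrite /And holds_not /holds /= addn_eq0 !subn_eq0 negbK !lt0n. Qed.

Lemma holds_or a b : holds (Plus a b) = holds a || holds b.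
Proof. by rewrite /holds /= addn_eq0 negb_and. Qed.

Lemma holds_leq a b : holds (Leq a b) = (eval N M V a <= eval N M V b).
Proof. by rewrite /Leq holds_not /holds /= negbK. Qed.
End Formulas.

Lemma holds_sum N M V i e :
  holds N M V (Sum i e) = [exists j : 'I_N, holds N M (upd V i j) e].
Proof. by rewrite /holds /= sum_nat_eq0 negb_forall. Qed.

Lemma holds_all N M V i e :
  holds N M V (All i e) = [forall j : 'I_N, holds N M (upd V i j) e].
Proof.
rewrite /All holds_not holds_sum negb_exists; apply: eq_forallb => j.
by rewrite holds_not negbK.
Qed.

(** * Memory layout *)

Definition tbase n := 3 + (n * n + (n + n)).
(** The table follows the input, in memory that is initially zero, so every entry starts out false.
    Its addresses have the base-[n] digits [c], [b], [x], [y]. *)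
Definition cell n c b x y := tbase n + (n * (n * (n * c + b) + x) + y).

(** The three cells skipped are n, the sign and the absolute value of k; the matrix of the profile,
    stored by rows, then S and T follow. *)
Definition edgeE a b := Get (Plus (Cst 3) (Plus (Mul (Var a)) (Var b))).
Definition inSE a := Get (Plus (Cst 3) (Plus (Mul Dim) (Var a))).
Definition inTE a := Get (Plus (Cst 3) (Plus (Mul Dim) (Plus Dim (Var a)))).
Definition cellE c b x y :=
  Plus (Plus (Cst 3) (Plus (Mul Dim) (Plus Dim Dim)))
    (Plus (Mul (Plus (Mul (Plus (Mul (Var c)) (Var b))) (Var x))) (Var y)).

Lemma eval_mul N M V e : (forall j, eval N M (upd V 0 j) e = eval N M V e) ->
  eval N M V (Mul e) = N * eval N M V e.
Proof.
by move=> h /=; under eq_bigr do rewrite h; rewrite sum_nat_const card_ord.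
Qed.

Lemma eval_plus N M V a b :
  eval N M V (Plus a b) = eval N M V a + eval N M V b.
Proof. by []. Qed.

Lemma eval_edge N M V a b :
  eval N M V (edgeE a.+1 b.+1) = M (3 + (N * V a.+1 + V b.+1)).
Proof. by rewrite -(@eval_mul N M V (Var a.+1)). Qed.

Lemma eval_inS N M V a : eval N M V (inSE a.+1) = M (3 + (N * N + V a.+1)).
Proof. by rewrite -(@eval_mul N M V Dim). Qed.

Lemma eval_inT N M V a : eval N M V (inTE a.+1) = M (3 + (N * N + (N + V a.+1))).
Proof. by rewrite -(@eval_mul N M V Dim). Qed.

Lemma eval_cell N M V c b x y :
  eval N M V (cellE c.+1 b.+1 x.+1 y.+1) =
  cell N (V c.+1) (V b.+1) (V x.+1) (V y.+1).
Proof.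
have e1 V' : eval N M V' (Mul (Var c.+1)) = N * V' c.+1 by apply: eval_mul.
have e2 V' : eval N M V' (Mul (Plus (Mul (Var c.+1)) (Var b.+1))) =
             N * (N * V' c.+1 + V' b.+1).
  by rewrite eval_mul => [|j]; rewrite !eval_plus !e1.
have e3 : eval N M V (Mul (Plus (Mul (Plus (Mul (Var c.+1)) (Var b.+1))) (Var x.+1))) =
          N * (N * (N * V c.+1 + V b.+1) + V x.+1).
  by rewrite eval_mul => [|j]; rewrite !eval_plus !e2.
by rewrite /cell -e3 /tbase -(@eval_mul N M V Dim).
Qed.

(** Uniqueness of base-[n] digits, extracted one at a time by quotient and remainder. *)
Lemma cell_inj n (c b x y c' b' x' y' : 'I_n) :
  cell n c b x y = cell n c' b' x' y' -> [/\ c = c', b = b', x = x' & y = y'].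
Proof.
have radix a a' (d d' : 'I_n) : n * a + d = n * a' + d' -> a = a' /\ d = d'.
  move=> e; have n0 : 0 < n by apply: leq_ltn_trans (ltn_ord d).
  have := congr1 (modn^~ n) e; have := congr1 (divn^~ n) e.
  rewrite ![n * _]mulnC !divnMDl // !modnMDl !divn_small // !modn_small //.
  by rewrite !addn0 => -> /val_inj.
by move=> /addnI/radix[/radix[/radix[/val_inj-> ->] ->] ->].
Qed.

Lemma nth_allpairs_row (A B C : Type) (f : A -> B -> C) s t z x y i j :
  i < size s -> j < size t ->
  nth z [seq f a b | a <- s, b <- t] (size t * i + j) =
  f (nth x s i) (nth y t j).
Proof.
elim: s i => [|a s IH] [|i] //= lt_i lt_j.
  by rewrite muln0 nth_cat size_map lt_j (nth_map y).
by rewrite mulnS -addnA nth_cat size_map ltnNge leq_addr /= addKn IH.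
Qed.

(** * Reading the encoded instance *)

Section Encoding.
Variables (n : nat) (phi : profile n) (S T : {set 'I_n}) (k : int).
Let w := encode_instance phi S T k.

Let rows := [seq nat_of_bool (phi a b) | a <- enum 'I_n, b <- enum 'I_n].

Lemma size_rows : size rows = n * n.
Proof. by rewrite size_allpairs !size_enum_ord. Qed.

Lemma size_encode : size w = tbase n.
Proof.
by rewrite /w /encode_instance -/rows !size_cat size_rows 2!size_map !size_enum_ord.
Qed.

Lemma nth_rows (a b : 'I_n) : nth 0 rows (n * a + b) = phi a b.
Proof.
rewrite -{1}(size_enum_ord n) (nth_allpairs_row _ _ _ _ _ _ _ a b) ?nth_ord_enum //.
- by rewrite size_enum_ord.
- by rewrite size_enum_ord.
Qed.

Lemma nth_encode q : nth 0 w (3 + q) =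
  nth 0 (rows ++ [seq nat_of_bool (a \in S) | a <- enum 'I_n] ++
                 [seq nat_of_bool (a \in T) | a <- enum 'I_n]) q.
Proof. by []. Qed.

Lemma nth_encode_edge (a b : 'I_n) : nth 0 w (3 + (n * a + b)) = phi a b.
Proof.
have lt : n * a + b < n * n.
  rewrite (@leq_trans (n * a + n)) ?ltn_add2l // -mulnSr leq_mul2l ltn_ord orbT //.
by rewrite nth_encode nth_cat size_rows lt nth_rows.
Qed.

Lemma nth_encode_S (a : 'I_n) : nth 0 w (3 + (n * n + a)) = (a \in S).
Proof.
rewrite nth_encode nth_cat size_rows ltnNge leq_addr /= addKn.
by rewrite nth_cat size_map size_enum_ord ltn_ord (nth_map a) ?size_enum_ord ?nth_ord_enum.
Qed.

Lemma nth_encode_T (a : 'I_n) : nth 0 w (3 + (n * n + (n + a))) = (a \in T).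
Proof.
rewrite nth_encode nth_cat size_rows ltnNge leq_addr /= addKn.
rewrite nth_cat size_map size_enum_ord ltnNge leq_addr /= addKn.
by rewrite (nth_map a) ?size_enum_ord ?nth_ord_enum.
Qed.
End Encoding.

(** * The program *)

(** Relaxation of the entry (c, b, x, y) given by variables 1 to 4: it becomes true if it was true,
    if x = y, or if y qualifies c and some z (variable 5) qualifying y is reached at a cost
    (variable 6) that leaves room for y, which costs 1 outside T. *)
Definition stepE :=
  Plus (Get (cellE 1 2 3 4))
    (Plus (And (Leq (Var 3) (Var 4)) (Leq (Var 4) (Var 3)))
      (And (edgeE 4 1)
        (Sum 5 (And (edgeE 5 4)
          (Sum 6 (And (Get (cellE 1 6 3 5))
                      (Leq (Plus (Var 6) (Not (inTE 4))) (Var 2)))))))).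

Definition round :=
  For 1 (For 2 (For 3 (For 4 (Put (cellE 1 2 3 4) stepE)))).

(** Cells 1 and 2 hold the sign and the absolute value of k. Variable 1 is the root c, 2 serves the
    consensus test, 3 and 4 are the terminals, 5 is the branching vertex, and 6 to 8 are the costs
    of the three paths. *)
Definition answerE :=
  And (Not (Get (Cst 1)))
    (Sum 1 (And (edgeE 1 1)
      (And (All 2 (Plus (Not (inTE 2)) (edgeE 2 1)))
        (All 3 (All 4 (Plus (Not (inSE 3)) (Plus (Not (inSE 4))
          (Sum 5 (Sum 6 (Sum 7 (Sum 8
            (And (Get (cellE 1 6 1 5))
            (And (Get (cellE 1 7 5 3))
            (And (Get (cellE 1 8 5 4))
              (Leq (Plus (Not (inTE 1)) (Plus (Var 6) (Plus (Var 7) (Var 8))))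
                   (Get (Cst 2))))))))))))))))).

(** Updates in place may turn entries true but never false again, so what was established for
    earlier cells survives. *)
Definition grows (M M' : nat -> nat) := forall a, M a != 0 -> M' a != 0.

(** Loop rule: [J] is an invariant, while [Q j] is achieved in round [j] and kept because later
    rounds only make the memory grow. *)
Lemma exec_For_grows N V i c M (J : (nat -> nat) -> Prop)
    (Q : 'I_N -> (nat -> nat) -> Prop) :
  (forall j M1 M2, grows M1 M2 -> Q j M1 -> Q j M2) ->
  (forall (j : 'I_N) M1, J M1 -> let M2 := exec N (upd V i j) c M1 in
     [/\ J M2, grows M1 M2 & Q j M2]) ->
  J M -> let M' := exec N V (For i c) M in
  [/\ J M', grows M M' & forall j, Q j M'].
Proof.
move=> Qup body JM /=.
suff H m : m <= N ->
    let M' := iteri m (fun j => exec N (upd V i j) c) M in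
    [/\ J M', grows M M' & forall j : 'I_N, j < m -> Q j M'].
  by have [JM' gM' QM'] := H N (leqnn N); split=> // j; apply: QM'.
elim: m => [|m IH] lt_m /=; first by split.
have [J1 g1 Q1] := IH (ltnW lt_m).
have [J2 g2 Q2] := body (Ordinal lt_m) _ J1.
split=> // [a /g1/g2 //|j].
rewrite ltnS leq_eqVlt => /orP[/eqP jm|/Q1]; last exact: Qup.
by have -> : j = Ordinal lt_m by apply: val_inj.
Qed.

(** * Correctness of the reachability table *)

Section Table.
Variables (n : nat) (phi : profile n) (S T : {set 'I_n}) (k : int).
Let w := encode_instance phi S T k.
Implicit Types (M V : nat -> nat) (c b x y z : 'I_n) (p : seq 'I_n).

Definition input_ok M := forall a, a < tbase n -> M a = nth 0 w a.

Definition tab M c b x y := M (cell n c b x y) != 0.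

Lemma holds_edge M V (a b : nat) (i j : 'I_n) : input_ok M ->
  V a.+1 = i -> V b.+1 = j -> holds n M V (edgeE a.+1 b.+1) = phi i j.
Proof.
move=> Mok Vi Vj; rewrite /holds eval_edge Vi Vj Mok ?nth_encode_edge ?eqb0 ?negbK //.
by rewrite /tbase ltn_add2l; have := ltn_ord i; have := ltn_ord j; nia.
Qed.

Lemma holds_inS M V a (i : 'I_n) : input_ok M ->
  V a.+1 = i -> holds n M V (inSE a.+1) = (i \in S).
Proof.
move=> Mok Vi; rewrite /holds eval_inS Vi Mok ?nth_encode_S ?eqb0 ?negbK //.
by rewrite /tbase; have := ltn_ord i; lia.
Qed.

Lemma eval_inT_ok M V a (i : 'I_n) : input_ok M ->
  V a.+1 = i -> eval n M V (inTE a.+1) = (i \in T).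
Proof.
move=> Mok Vi; rewrite eval_inT Vi Mok ?nth_encode_T //.
by rewrite /tbase; have := ltn_ord i; lia.
Qed.

Lemma holds_inT M V a (i : 'I_n) : input_ok M ->
  V a.+1 = i -> holds n M V (inTE a.+1) = (i \in T).
Proof. by move=> Mok Vi; rewrite /holds (eval_inT_ok M V a i) // eqb0 negbK. Qed.

Lemma eval_notT M V a (i : 'I_n) : input_ok M ->
  V a.+1 = i -> eval n M V (Not (inTE a.+1)) = (i \notin T).
Proof.
move=> Mok Vi; rewrite -[LHS]/(1 - eval n M V (inTE a.+1)) (eval_inT_ok M V a i) //.
by case: (i \in T).
Qed.

Lemma holds_cell M V c b x y (c' b' x' y' : nat) :
  V c'.+1 = c -> V b'.+1 = b -> V x'.+1 = x -> V y'.+1 = y ->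
  holds n M V (Get (cellE c'.+1 b'.+1 x'.+1 y'.+1)) = tab M c b x y.
Proof. by move=> Vc Vb Vx Vy; rewrite /tab -Vc -Vb -Vx -Vy -(eval_cell n M). Qed.

Lemma holds_stepE M V c b x y : input_ok M ->
  V 1 = c -> V 2 = b -> V 3 = x -> V 4 = y ->
  holds n M V stepE =
  [|| tab M c b x y, x == y |
    phi y c && [exists z, phi z y &&
      [exists b', tab M c b' x z && (b' + (y \notin T) <= b)]]].
Proof.
move=> Mok V1 V2 V3 V4.
rewrite /stepE !holds_or !holds_and !holds_leq (holds_cell M V c b x y) //.
rewrite (holds_edge M V _ _ y c) // holds_sum.
congr [|| _, _ | _ && _].
  by rewrite [eval _ _ _ _]V3 [eval _ _ _ _]V4 -eqn_leq.
apply: eq_existsb => z; rewrite holds_and (holds_edge _ _ _ _ z y) // holds_sum.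
congr (_ && _); apply: eq_existsb => b'.
rewrite holds_and (holds_cell _ _ c b' x z) // holds_leq eval_plus.
by rewrite (eval_notT _ _ _ y) // [eval _ _ _ (Var 2)]V2.
Qed.

(** The start [x] is neither charged nor tested against [c], so walks can be chained at a branching
    vertex without charging it twice. *)
Definition walk c b x y p :=
  [/\ path phi x p, last x p = y, all (phi^~ c) p &
      count (fun u => u \notin T) p <= b].

(** Soundness sets no limit on the length, since a round may use entries that it has just written;
    completeness after [m] rounds covers walks with fewer than [m] steps. *)
Definition sound M := forall c b x y, tab M c b x y -> exists p, walk c b x y p.
Definition complete m M := forall c b x y p,
  size p < m -> walk c b x y p -> tab M c b x y.

Lemma complete_grows m M M' : grows M M' -> complete m M -> complete m M'.
Proof. by move=> g h c b x y p sp wp; apply: g; apply: h sp wp. Qed.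

Definition table_inv m M := [/\ input_ok M, sound M & complete m M].

(** The share of a single cell in [complete m.+1]. *)
Definition filled m c b x y M :=
  forall p, size p < m.+1 -> walk c b x y p -> tab M c b x y.

(** Walks are seen through their last step: soundness appends [y] to a walk ending in some [z],
    completeness removes the last vertex. *)
Lemma exec_Put m M V c b x y : table_inv m M ->
  V 1 = c -> V 2 = b -> V 3 = x -> V 4 = y ->
  let M' := exec n V (Put (cellE 1 2 3 4) stepE) M in
  [/\ table_inv m M', grows M M' & filled m c b x y M'].
Proof.
move=> [Mok Msound Mcomp] V1 V2 V3 V4 M'.
have eM' : M' = upd M (cell n c b x y) (eval n M V stepE).
  by rewrite /M' -V1 -V2 -V3 -V4 -(eval_cell n M).
have step := holds_stepE M V c b x y Mok V1 V2 V3 V4.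
have gM' : grows M M'.
  move=> a Ma; rewrite eM' /upd; case: (a =P _) => // ea.
  by rewrite -/(holds n M V stepE) step /tab -ea Ma.
have M'cell : tab M' c b x y = holds n M V stepE.
  by rewrite /tab eM' /upd eqxx.
split=> //; first split.
(* Table cells start at [tbase n], so no input cell is overwritten. *)
- move=> a la; rewrite eM' /upd; case: eqP => [ea|_]; last exact: Mok.
  by rewrite /cell in ea; lia.
- move=> c1 b1 x1 y1.
  have [/cell_inj[-> -> -> ->]|ne] := eqVneq (cell n c1 b1 x1 y1) (cell n c b x y).
    rewrite M'cell step => /or3P[/Msound //|/eqP <-|].
      by exists [::].
    case/andP=> yc /existsP[z /andP[zy /existsP[b' /andP[/Msound[p [pp lp ap cp]] le_b]]]].
    exists (rcons p y); split.
    + by rewrite rcons_path pp lp.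
    + by rewrite last_rcons.
    + by rewrite all_rcons /= yc.
    + by rewrite -cats1 count_cat /= addn0 (leq_trans _ le_b) // leq_add2r.
  by rewrite /tab eM' /upd (negbTE ne); apply: Msound.
- exact: complete_grows Mcomp.
- move=> p sp [pp lp ap cp]; rewrite M'cell step.
  case/lastP: p sp pp lp ap cp => [|p u] sp pp lp ap cp.
    by rewrite -lp eqxx orbT.
  rewrite last_rcons in lp; rewrite lp in pp ap cp.
  rewrite rcons_path in pp; rewrite all_rcons in ap.
  case/andP: pp => pp zy; case/andP: ap => yc ap.
  apply/or3P; apply: Or33; rewrite /= in yc; rewrite yc /=.
  apply/existsP; exists (last x p); rewrite zy /=.
  rewrite -cats1 count_cat /= addn0 in cp.
  (* The cost of the shortened walk is at most [b], hence below [n] and a legal table index. *)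
  have lt_b' : count (fun u => u \notin T) p < n.
    by apply: leq_ltn_trans (ltn_ord b); apply: leq_trans cp; apply: leq_addr.
  apply/existsP; exists (Ordinal lt_b'); rewrite /= cp andbT.
  apply: (Mcomp _ _ _ _ p); last by split.
  by rewrite size_rcons ltnS in sp.
Qed.

Lemma grows_filled m c b x y M M' :
  grows M M' -> filled m c b x y M -> filled m c b x y M'.
Proof. by move=> g h p sp wp; apply: g; apply: h sp wp. Qed.

(** Throughout the round [complete m] stays true, so each cell is filled when visited and remains
    so. *)
Lemma exec_round m M V : table_inv m M ->
  table_inv m.+1 (exec n V round M).
Proof.
move=> inv.
have [||[ok snd _] _ all_filled] := exec_For_grows n V 1
  (For 2 (For 3 (For 4 (Put (cellE 1 2 3 4) stepE)))) M (table_inv m)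
  (fun c M => forall b x y, filled m c b x y M) _ _ inv.
- by move=> c M1 M2 g h b x y; apply: grows_filled g _.
- move=> c M1 inv1; apply: (exec_For_grows _ _ _ _ _ (table_inv m)
      (fun b M' => forall x y, filled m c b x y M')) inv1.
    by move=> b M2 M3 g h x y; apply: grows_filled g _.
  move=> b M2 inv2; apply: (exec_For_grows _ _ _ _ _ (table_inv m)
      (fun x M' => forall y, filled m c b x y M')) inv2.
    by move=> x M3 M4 g h y; apply: grows_filled g _.
  move=> x M3 inv3; apply: (exec_For_grows _ _ _ _ _ (table_inv m)
      (fun y M' => filled m c b x y M')) inv3.
    by move=> y M4 M5 g; apply: grows_filled g.
  by move=> y M4 inv4; apply: exec_Put.
by split=> // c b x y p; apply: all_filled.
Qed.

Lemma exec_fill V : table_inv n (exec n V (For 7 round) (nth 0 w)).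
Proof.
suff H m : table_inv m (iteri m (fun j => exec n (upd V 7 j) round) (nth 0 w)).
  exact: H.
elim: m => [|m IH]; last exact: exec_round.
(* Before the first round all table cells are zero, so soundness is vacuous, as is completeness for
   walks with fewer than 0 steps. *)
split=> // c b x y /negP[]; apply/eqP.
by apply: nth_default; rewrite size_encode leq_addr.
Qed.

Lemma holds_answerE M V : input_ok M -> holds n M V answerE =
  ~~ (k < 0)%R && [exists c, [&& phi c c, [forall t, (t \in T) ==> phi t c] &
    [forall s1, forall s2, (s1 \in S) ==> (s2 \in S) ==>
      [exists v, exists b1, exists b2, exists b3,
        [&& tab M c b1 c v, tab M c b2 v s1, tab M c b3 v s2 &
            (c \notin T) + (b1 + (b2 + b3)) <= `|k|%N]]]]].
Proof.
move=> Mok; rewrite /answerE holds_and holds_not; congr (_ && _).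
  rewrite /holds -[eval _ _ _ _]/(M 1) (Mok 1) // -[nth _ _ _]/(nat_of_bool (k < 0)%R).
  by rewrite eqb0 negbK.
rewrite holds_sum; apply: eq_existsb => c.
rewrite !holds_and (holds_edge _ _ _ _ c c) // !holds_all.
congr [&& _, _ & _].
  apply: eq_forallb => t.
  by rewrite holds_or holds_not (holds_inT _ _ _ t) // (holds_edge _ _ _ _ t c) // implybE.
apply: eq_forallb => s1; rewrite holds_all; apply: eq_forallb => s2.
rewrite !holds_or !holds_not (holds_inS _ _ _ s1) // (holds_inS _ _ _ s2) // !implybE.
congr [|| _, _ | _].
rewrite holds_sum; apply: eq_existsb => v.
rewrite holds_sum; apply: eq_existsb => b1.
rewrite holds_sum; apply: eq_existsb => b2.
rewrite holds_sum; apply: eq_existsb => b3.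
rewrite !holds_and (holds_cell _ _ c b1 c v) // (holds_cell _ _ c b2 v s1) //.
rewrite (holds_cell _ _ c b3 v s2) // holds_leq eval_plus (eval_notT _ _ _ c) //=.
by rewrite (Mok 2).
Qed.
End Table.

(** * Reduction to two terminals *)

Section Closure.
Variables (n : nat) (phi : profile n) (T : {set 'I_n}).

Lemma csrK_sub l a : a \in csrK phi T l -> a \in T.
Proof.
elim: l a => [|l IH] a /=; rewrite !inE; first by case/andP.
by case/orP => [/IH|/andP[]].
Qed.

Lemma csrK0P a :
  reflect (a \in T /\ forall u, u \in T -> phi u a) (a \in csrK phi T 0).
Proof.
rewrite /= inE; apply: (iffP andP) => [[aT /forall_inP h]|[aT h]]; split=> //.
exact/forall_inP.
Qed.

Lemma in_fCSR_step u a :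
  in_fCSR phi T u -> phi u a -> a \in T -> in_fCSR phi T a.
Proof.
move=> [l ul] ua aT; exists l.+1; rewrite /= !inE aT; apply/orP; right.
by apply/exists_inP; exists u.
Qed.

Lemma in_fCSR_path u p : in_fCSR phi T u -> path phi u p ->
  {subset p <= T} -> in_fCSR phi T (last u p).
Proof.
elim: p u => [//|a p IH] u fu /= /andP[ua pp] pT.
apply: IH => //; last by move=> z zp; apply: pT; rewrite inE zp orbT.
by apply: in_fCSR_step ua _ => //; apply: pT; rewrite mem_head.
Qed.

(** The whole closure grows out of [csrK phi T 0]; this supplies the root of the paths. *)
Lemma in_fCSR_consensus a : in_fCSR phi T a -> exists c, c \in csrK phi T 0.
Proof.
move=> [l]; elim: l a => [|l IH] a; first by exists a.
by rewrite /= !inE => /orP[/IH //|/andP[_ /exists_inP[u /IH]]].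
Qed.

Variable c : 'I_n.
Hypothesis cK : c \in csrK phi T 0.

(** One fixed root [c] suffices: any other consensus start is qualified by all of [T], in particular
    by [c], and so is one step away. *)
Lemma in_fCSR_pathP a : in_fCSR phi T a ->
  exists p, [/\ path phi c p, last c p = a & {subset p <= T}].
Proof.
have [cT _] := csrK0P _ cK.
move=> [l]; elim: l a => [|l IH] a.
  case/csrK0P=> aT /(_ c cT) ca; exists [:: a]; split; rewrite /= ?ca //.
  by move=> u; rewrite inE => /eqP->.
rewrite [csrK _ _ _.+1]/= !inE => /orP[/IH //|/andP[aT /exists_inP[u /IH]]].
move=> [p [pp lp pT]] ua.
exists (rcons p a); split; rewrite ?last_rcons ?rcons_path ?pp ?lp //.
by move=> z; rewrite mem_rcons inE => /predU1P[->|/pT].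
Qed.

Lemma in_fCSR_pred a : in_fCSR phi T a ->
  exists u, [/\ in_fCSR phi T u, u \in T & phi u a].
Proof.
have [cT _] := csrK0P _ cK.
move=> [l]; elim: l a => [|l IH] a.
  by case/csrK0P=> _ /(_ c cT) ca; exists c; split=> //; exists 0.
rewrite [csrK _ _ _.+1]/= !inE => /orP[/IH //|/andP[aT /exists_inP[u ul ua]]].
by exists u; split=> //; [exists l | apply: csrK_sub ul].
Qed.
End Closure.

Definition interval_order {n} (phi : profile n) (pos : 'I_n -> nat) :=
  forall a x y z, pos x <= pos y -> pos y <= pos z ->
    phi a x -> phi a z -> phi a y.

Lemma QC_interval_order n (phi : profile n) :
  QC phi -> exists pos, interval_order phi pos.
Proof.
case=> sigma h; exists (fun a => val ((sigma^-1)%g a)) => a x y z xy yz.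
by have := h a _ _ _ xy yz; rewrite !permKV.
Qed.

(** A predecessor [u] of [a] in the closure qualifies both [a] and the consensus start [c], hence
    also [s], which lies between them. *)
Lemma in_fCSR_between n (phi : profile n) T pos c a s :
  interval_order phi pos -> c \in csrK phi T 0 -> s \in T ->
  in_fCSR phi T a ->
  (pos a <= pos s <= pos c) || (pos c <= pos s <= pos a) -> in_fCSR phi T s.
Proof.
move=> ord cK sT fa between.
have [u [fu uT ua]] := in_fCSR_pred n phi T c cK a fa.
have [_ /(_ u uT) uc] := csrK0P _ _ _ _ cK.
apply: in_fCSR_step fu _ sT.
by case/orP: between => /andP[l1 l2]; [apply: ord ua uc | apply: ord uc ua].
Qed.

(** * Branching of two paths with a common root *)

Lemma split_last (A : Type) (a : pred A) x q : a x ->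
  exists r1 r2, [/\ q = r1 ++ r2, a (last x r1) & ~~ has a r2].
Proof.
move=> ax; elim/last_ind: q => [|q u [r1 [r2 [-> ar1 ar2]]]].
  by exists [::], [::].
case: (boolP (a u)) => au.
  by exists (rcons (r1 ++ r2) u), [::]; rewrite cats0 last_rcons.
by exists r1, (rcons r2 u); rewrite rcons_cat has_rcons negb_or au.
Qed.

(** After both paths are made simple, the branching vertex is the last vertex of the second one that
    lies on the first. The second path is kept only from there on, where it avoids the first, so no
    vertex is repeated. *)
Lemma fork (A : eqType) (e : rel A) c q1 q2 :
  path e c q1 -> path e c q2 ->
  exists p1 p2 p3,
    [/\ [/\ path e c p1, path e (last c p1) p2 & path e (last c p1) p3],
        last (last c p1) p2 = last c q1, last (last c p1) p3 = last c q2,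
        uniq (c :: p1 ++ p2 ++ p3) & {subset p1 ++ p2 ++ p3 <= q1 ++ q2}].
Proof.
move=> /shortenP[p1 pp1 up1 sp1] /shortenP[p2 pp2 up2 sp2].
have [r1 [r2 [ep2 vr1 nr2]]] := split_last _ [in c :: p1] c p2 (mem_head _ _).
move: pp2 up2 sp2; rewrite {}ep2 => pp2 up2 sp2.
move: up1 nr2 sp1 pp1; case/splitPl: vr1 => s1 s2 es1 up1 nr2 sp1 pp1.
exists s1, s2, r2; rewrite es1.
move: pp1 pp2; rewrite !cat_path -es1 => /andP[-> ->] /andP[_ pr2].
rewrite es1 in pr2 *; rewrite pr2 !last_cat es1; split=> //.
- rewrite catA -cat_cons cat_uniq up1 nr2.
  by move: up2; rewrite -cat_cons cat_uniq => /and3P[].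
- move=> u; rewrite catA !mem_cat => /orP[us|ur].
    by rewrite sp1 ?mem_cat.
  by rewrite sp2 ?orbT // mem_cat ur orbT.
Qed.

(** * The two-terminal test decides the problem *)

Section Steiner.
Variables (n : nat) (phi : profile n) (S T : {set 'I_n}) (k : int).
Variable M : nat -> nat.
Hypotheses (Msound : sound n phi T M) (Mcomplete : complete n phi T n M).
Hypotheses (S0 : S != set0) (ST : S \subset T) (phiQC : QC phi).

(** The summand [c \notin T] charges the root, which is not charged as the start of a walk. *)
Definition steiner (c s1 s2 : 'I_n) : bool :=
  [exists v, exists b1, exists b2, exists b3,
    [&& tab n M c b1 c v, tab n M c b2 v s1, tab n M c b3 v s2 &
        (c \notin T) + (b1 + (b2 + b3)) <= `|k|%N]].

Definition solvable : bool :=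
  ~~ (k < 0)%R && [exists c, [&& phi c c, [forall t, (t \in T) ==> phi t c] &
    [forall s1, forall s2, (s1 \in S) ==> (s2 \in S) ==> steiner c s1 s2]]].

Lemma solvable_GCAI : solvable -> GCAI_CSR phi S T k.
Proof.
case/andP=> k0 /existsP[c /and3P[cc /forall_inP Tc all_steiner]].
have [pos ord] := QC_interval_order _ _ phiQC.
have /set0Pn[s0 s0S] := S0.
(* The test holds for all pairs of S; only the two extreme positions are used. *)
pose s1 := [arg min_(s < s0 in S) pos s]; pose s2 := [arg max_(s > s0 in S) pos s].
have [s1S s1min] : s1 \in S /\ forall s, s \in S -> pos s1 <= pos s.
  by rewrite /s1; case: arg_minnP.
have [s2S s2max] : s2 \in S /\ forall s, s \in S -> pos s <= pos s2.
  by rewrite /s2; case: arg_maxnP.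
have := forallP (forallP all_steiner s1) s2; rewrite s1S s2S /=.
case/existsP=> v /existsP[b1 /existsP[b2 /existsP[b3 /and4P[]]]].
move=> /Msound[p1 [pp1 lp1 cp1 bp1]] /Msound[p2 [pp2 lp2 cp2 bp2]].
move=> /Msound[p3 [pp3 lp3 cp3 bp3]] cost.
pose L := c :: p1 ++ p2 ++ p3; pose U := [set u in [seq u <- L | u \notin T]].
have UT u : (u \in T :|: U) = (u \in T) || (u \in L).
  by rewrite !inE mem_filter; case: (u \in T).
have sub p : {subset p <= L} -> {subset p <= T :|: U}.
  by move=> pL u /pL uL; rewrite UT uL orbT.
(* The walks visit only individuals qualifying [c], so adding them preserves the consensus on
   [c]. *)
have cK : c \in csrK phi (T :|: U) 0.
  apply/csrK0P; split; first by rewrite UT mem_head orbT.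
  move=> u; rewrite UT => /orP[/Tc //|].
  rewrite inE => /predU1P[-> //|].
  by rewrite !mem_cat => /or3P[/(allP cp1)|/(allP cp2)|/(allP cp3)].
have fc : in_fCSR phi (T :|: U) c by exists 0.
have fv : in_fCSR phi (T :|: U) v.
  rewrite -lp1; apply: in_fCSR_path => //; apply: sub => u up.
  by rewrite inE mem_cat up orbT.
have fs1 : in_fCSR phi (T :|: U) s1.
  rewrite -lp2; apply: in_fCSR_path => //; apply: sub => u up.
  by rewrite inE !mem_cat up !orbT.
have fs2 : in_fCSR phi (T :|: U) s2.
  rewrite -lp3; apply: in_fCSR_path => //; apply: sub => u up.
  by rewrite inE !mem_cat up !orbT.
exists U; split.
- by apply/subsetP => u; rewrite !inE mem_filter => /andP[].
- have : #|U| <= `|k|%N.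
    (* The walks may overlap, so the sum of their costs is only an upper bound for the size of
       [U]. *)
    rewrite cardsE; apply: leq_trans (card_size _) _; rewrite size_filter.
    apply: leq_trans cost; rewrite /L /= !count_cat leq_add2l.
    by rewrite !leq_add.
  by move: k0; clear; lia.
- move=> s sS; have sT : s \in T :|: U by rewrite UT (subsetP ST).
  (* On either side of [c], [s] lies between [c] and the extreme member of S on that side. *)
  have [le|/ltnW le] := leqP (pos s) (pos c).
    by apply: in_fCSR_between ord cK sT fs1 _; rewrite s1min // le.
  by apply: in_fCSR_between ord cK sT fs2 _; rewrite s2max // le orbT.
Qed.

(** Paths to the two terminals inside [T :|: U] are merged by [fork]; all their vertices qualify the
    consensus start, and the individuals paid for are distinct members of [U]. *)
Lemma GCAI_solvable : GCAI_CSR phi S T k -> solvable.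
Proof.
move=> [U [UT Uk fS]]; apply/andP; split.
  by move: Uk; clear; lia.
have /set0Pn[s0 s0S] := S0.
have [c cK] := in_fCSR_consensus _ _ _ _ (fS _ s0S).
have [cT Tc] := csrK0P _ _ _ _ cK.
apply/existsP; exists c; apply/and3P; split; first exact: Tc.
  by apply/forall_inP => t tT; apply: Tc; rewrite inE tT.
apply/forallP => s1; apply/forallP => s2; apply/implyP => s1S; apply/implyP => s2S.
have [q1 [pq1 <- q1T]] := in_fCSR_pathP _ _ _ _ cK _ (fS _ s1S).
have [q2 [pq2 <- q2T]] := in_fCSR_pathP _ _ _ _ cK _ (fS _ s2S).
have [p1 [p2 [p3 [[pp1 pp2 pp3] <- <- un sub]]]] := fork _ _ _ _ _ pq1 pq2.
set L := p1 ++ p2 ++ p3 in un sub.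
have LT u : u \in L -> u \in T :|: U.
  by move/sub; rewrite mem_cat => /orP[/q1T|/q2T].
(* The root and the three pieces are distinct individuals, so each piece has fewer than n steps:
   completeness after n rounds applies, and the costs are legal indices. *)
have lt_size : size p1 + (size p2 + size p3) < n.
  rewrite -!size_cat -/L -[n in _ < n]card_ord.
  by rewrite -[_.+1]/(size (c :: L)) -(card_uniqP un) max_card.
pose cnt := count (fun u => u \notin T).
have lt_cnt p : size p < n -> cnt p < n by apply: leq_ltn_trans (count_size _ _).
have /and3P[lt1 lt2 lt3] : [&& size p1 < n, size p2 < n & size p3 < n].
  by move: lt_size; clear; lia.
have Lc p : {subset p <= L} -> all (phi^~ c) p.
  by move=> pL; apply/allP => u /pL /LT; apply: Tc.
apply/existsP; exists (last c p1).
apply/existsP; exists (Ordinal (lt_cnt _ lt1)).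
apply/existsP; exists (Ordinal (lt_cnt _ lt2)).
apply/existsP; exists (Ordinal (lt_cnt _ lt3)).
apply/and4P; split.
- apply: (Mcomplete _ _ _ _ _ lt1); split=> //; apply: Lc => u up.
  by rewrite !mem_cat up.
- apply: (Mcomplete _ _ _ _ _ lt2); split=> //; apply: Lc => u up.
  by rewrite !mem_cat up orbT.
- apply: (Mcomplete _ _ _ _ _ lt3); split=> //; apply: Lc => u up.
  by rewrite !mem_cat up !orbT.
rewrite /= -!count_cat -/L.
have Uk' : #|U| <= `|k|%N by move: Uk; clear; lia.
(* The total cost counts vertices outside [T] in a repetition-free list, and each of them belongs to
   [U]. *)
rewrite -[_ + _]/(count (fun u => u \notin T) (c :: L)); apply: leq_trans Uk'.
rewrite -size_filter cardE; apply: uniq_leq_size; first exact: filter_uniq.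
move=> u; rewrite mem_filter mem_enum => /andP[uT]; rewrite inE.
case/predU1P=> [uc|/LT]; last by rewrite inE (negbTE uT).
by move: cT; rewrite -uc inE (negbTE uT).
Qed.
End Steiner.

(* There is a RAM program P and a polynomial bound c * (|w|+1)^d such that
   on every (encoded) GCAI instance with a QC profile, P halts within the
   bound and outputs 1 on yes-instances and 0 on no-instances. *)
Theorem theorem5 :
  exists (P : seq instr) (c d : nat),
    forall (n : nat) (phi : profile n) (S T : {set 'I_n}) (k : int),
      S != set0 -> S \subset T -> QC phi ->
      let w := encode_instance phi S T k in
      exists b : bool,
        run P (c * (size w).+1 ^ d) (init_config w) = Some (nat_of_bool b)
        /\ (b <-> GCAI_CSR phi S T k).
Proof.
(* The double negation turns any nonzero value into the output 1. *)
have [A [d runP]] := run_compile (For 7 round) (Not (Not answerE)).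
exists (compile (For 7 round) (Not (Not answerE))), A, d.
move=> n phi S T k S0 ST phiQC w.
have n_le : n <= size w by rewrite size_encode /tbase; lia.
pose V v := if v is 0 then size w else 0.
have [Mok Msound Mcomplete] := exec_fill n phi S T k V.
set M := exec _ _ _ _ in Mok Msound Mcomplete.
exists (solvable n phi S T k M); split.
  rewrite (runP w n_le) -[nth 0 w 0]/n -/V -/M; congr Some.
  rewrite /solvable -(holds_answerE n phi S T k M V Mok) /holds.
  by rewrite -[LHS]/(1 - (1 - eval n M V answerE)); case: eval.
split; first exact: solvable_GCAI.
exact: GCAI_solvable.
Qed.
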